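(* Let $\alpha=\{A_n:n\in\mathbb{N}\}$ be a partition of the unit interval (as described in the context) which is expansive of exponent $\theta\geq 0$ and eventually decreasing. Let $$F_\infty^{(\alpha)}:=\left\{x=[\ell_1(x),\ell_2(x),\ldots]_\alpha:\ \lim_{n\to\infty}\ell_n(x)=\infty\ \text{ and }\ \ell_n(x)\geq\ell_{n-1}(x)\text{ for all } n\ge 2\right\}$$ and $$G_\infty^{(\alpha)}:=\left\{x=[\ell_1(x),\ell_2(x),\ldots]_\alpha:\ \lim_{n\to\infty}\ell_n(x)=\infty\right\}.$$ Then $$\dim_H\left(F_\infty^{(\alpha)}\right)=\dim_H\left(G_\infty^{(\alpha)}\right)=\frac{1}{1+\theta}.$$
   Context: $\mathbb{N}=\{1,2,3,\ldots\}$, and $\dim_H$ denotes Hausdorff dimension. Partition: $\alpha=\{A_n:n\in\mathbb{N}\}$ is a countable partition of the unit interval consisting of right-closed, left-open intervals, ordered from right to left starting from $A_1$. Let $a_n>0$ be the Lebesgue measure of $A_n$ and $t_n:=\sum_{k=n}^\infty a_k$ (so $t_1=1$ and $A_n=(t_{n+1},t_n]$). $\alpha$-Lüroth map: $L_\alpha:[0,1]\to[0,1]$, $L_\alpha(x)=(t_n-x)/a_n$ for $x\in A_n$, $n\in\mathbb{N}$, and $L_\alpha(0)=0$. $\alpha$-Lüroth expansion: for $x\in[0,1]$, the finite or infinite sequence $(\ell_k)_{k\ge1}=(\ell_k(x))_{k\geq 1}$ of positive integers is determined by $L_\alpha^{k-1}(x)\in A_{\ell_k}$; it is finite if $L_\alpha^k(x)=0$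 for some $k$. If it is infinite, write $x=[\ell_1,\ell_2,\ell_3,\ldots]_\alpha$; then $x=t_{\ell_1}+\sum_{n=2}^\infty(-1)^{n-1}\left(\prod_{i<n}a_{\ell_i}\right)t_{\ell_n}$. $\alpha$ is expansive of exponent $\theta\ge 0$ if $t_n=\psi(n)\,n^{-\theta}$ for all $n\in\mathbb{N}$, where $\psi:\mathbb{N}\to\mathbb{R}^+$ is slowly varying, i.e. the restriction to $\mathbb{N}$ of a measurable $f:\mathbb{R}^+\to\mathbb{R}^+$ with $\lim_{x\to\infty}f(xy)/f(x)=1$ for all $y>0$. $\alpha$ is eventually decreasing if $a_n<a_{n-1}$ for all sufficiently large $n\in\mathbb{N}$. *)

(* Defs.v *)
From HB Require Import structures.
From mathcomp Require Import all_boot all_order all_algebra.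
From mathcomp Require Import all_classical all_reals all_analysis.
Set Implicit Arguments.
Unset Strict Implicit.
Unset Printing Implicit Defensive.
Import Order.TTheory GRing.Theory Num.Theory.
Import numFieldNormedType.Exports.
Local Open Scope classical_set_scope.
Local Open Scope ring_scope.

Section Hausdorff.
Context {R : realType}.
Implicit Types (s d : R) (E U : set R).

(* The supremum is [-oo] on [set0]; [diam_pow] treats that case apart. *)
Definition diam U : \bar R :=
  ereal_sup [set `|x - y|%:E | x in U & y in U].

(* [diam U] to the power [s]; the empty set has weight 0 even for [s = 0],
   where a nonempty set has weight 1. *)
Definition diam_pow s U : \bar R :=
  if U == set0 then 0%E else poweR (diam U) s.

Definition hausdorff_premeasure s d E : \bar R :=
  ereal_inf [set (\sum_(0 <= i <oo) diam_pow s (U i))%E | U in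
    [set U : nat -> set R | E `<=` \bigcup_i U i /\
                            forall i, (diam (U i) <= d%:E)%E]].

(* The premeasure increases as [d] decreases to 0, so its limit at 0 is the
   supremum over all [d > 0]. *)
Definition hausdorff_measure s E : \bar R :=
  ereal_sup [set hausdorff_premeasure s d E | d in [set d | 0 < d]].

Definition hausdorff_dim E : \bar R :=
  ereal_inf [set s%:E | s in [set s | 0 <= s /\ hausdorff_measure s E = 0%E]].

End Hausdorff.

(* Below, sequences indexed by the positive integers are functions on [nat]
   whose value at 0 is irrelevant. *)

Section Luroth.
Context {R : realType}.

Record luroth_partition (A : nat -> set R) : Prop := LurothPartition {
  luroth_partition_itv : forall n, (0 < n)%N ->
    exists u v : R, u < v /\ A n = `]u, v]%classic ;
  luroth_partition_triv : trivIset [set n | (0 < n)%N] A ;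
  (* The cells are left-open, so 0 lies in none of them. *)
  luroth_partition_cover : \bigcup_(n in [set n | (0 < n)%N]) A n = `]0, 1]%classic ;
  luroth_partition_order : forall m n x y, (0 < m)%N -> (m < n)%N ->
    A m x -> A n y -> y < x }.

Variable A : nat -> set R.

Definition cell_length (n : nat) : R := fine (lebesgue_measure (A n)).

Definition cell_tail (n : nat) : R := limn (fun N => \sum_(n <= k < N) cell_length k).

(* The index [n >= 1] of the cell containing [x], and 0 if there is none
   (which, on the unit interval, happens only at [x = 0]). *)
Definition cell_index (x : R) : nat :=
  xget 0%N [set n | (0 < n)%N /\ A n x].

Definition luroth_map (x : R) : R :=
  if cell_index x == 0%N then 0
  else (cell_tail (cell_index x) - x) / cell_length (cell_index x).

(* The [k]-th digit, [k >= 1]; meaningful only as long as the expansion has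
   not terminated. *)
Definition luroth_digit (x : R) (k : nat) : nat :=
  cell_index (iter k.-1 luroth_map x).

Definition infinite_expansion (x : R) : Prop :=
  forall k, iter k luroth_map x <> 0.

Definition G_infty : set R :=
  [set x | [/\ 0 <= x <= 1, infinite_expansion x &
               luroth_digit x @ \oo --> \oo]].

Definition F_infty : set R :=
  [set x | [/\ 0 <= x <= 1, infinite_expansion x,
               luroth_digit x @ \oo --> \oo &
               forall n, (2 <= n)%N ->
                 (luroth_digit x n.-1 <= luroth_digit x n)%N]].

Definition slowly_varying (psi : nat -> R) : Prop :=
  exists f : R -> R,
    [/\ measurable_fun (`]0, +oo[%classic : set R) f,
        forall x, 0 < x -> 0 < f x,
        forall y, 0 < y -> f (x * y) / f x @[x --> +oo] --> (1 : R) &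
        forall n, (0 < n)%N -> psi n = f n%:R].

Definition expansive (theta : R) : Prop :=
  exists2 psi : nat -> R, slowly_varying psi &
    forall n, (0 < n)%N -> cell_tail n = psi n * n%:R `^ (- theta).

Definition eventually_decreasing : Prop :=
  \forall n \near \oo, cell_length n < cell_length n.-1.

End Luroth.

(* Main.v *)
(* Upper bound: for [s > 1 / (1 + theta)] the cell lengths satisfy
   [\sum_(n >= N) a n `^ s <= 1/2] for some [N]. The set of points all of whose
   digits are at least [N] is covered by its images under the branches
   [x |-> t n - a n * x], [n >= N], so its [s]-premeasure is at most half of
   itself, hence 0; points whose digits are only eventually at least [N] lie in
   countably many affine copies.
   Lower bound: for [s < 1 / (1 + theta)] one has [a n `^ (1 - s) <= t n.+1] for
   large [n]. Choose strictly increasing random digits, a digit [j] being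
   followed by [k > j] with probability [a k / t j.+1]. The point with these
   digits lies in [F_infty], and the inequality above says exactly that the
   uniform parameter is an [s]-Hoelder function of the point, so [F_infty] has
   positive [s]-measure.
   Both inequalities need only the ratio test along powers of 2, as
   [t (2 * n) / t n --> 2 `^ (- theta)] and [a (2 * n) <= t n / n]. *)
Require Import Defs.
From mathcomp Require Import all_boot all_order all_algebra.
From mathcomp Require Import all_classical all_reals all_analysis.
From mathcomp Require Import zify ring lra.
Set Implicit Arguments.
Unset Strict Implicit.
Unset Printing Implicit Defensive.
Import Order.TTheory GRing.Theory Num.Theory.
Import numFieldNormedType.Exports.
Local Open Scope classical_set_scope.
Local Open Scope ring_scope.

(** * General properties of Hausdorff premeasures, measures and dimension *)

Section HausdorffFacts.
Context {R : realType}.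
Implicit Types (s d : R) (E U : set R).
Local Open Scope ereal_scope.

Lemma diam_pow_ge0 s U : 0 <= diam_pow s U.
Proof. by rewrite /diam_pow; case: ifP => // _; exact: poweR_ge0. Qed.

Lemma diam_pow_set0 s : diam_pow s (@set0 R) = 0.
Proof. by rewrite /diam_pow eqxx. Qed.

Lemma diam_pow_neq0 s U : U !=set0 -> diam_pow s U = poweR (diam U) s.
Proof. by rewrite /diam_pow; case: eqP => // -> []. Qed.

Lemma diam_ge0 U : U !=set0 -> 0 <= diam U.
Proof.
move=> [x Ux]; apply: ereal_sup_ubound; exists x => //; exists x => //.
by rewrite subrr normr0.
Qed.

Lemma le_diam U x y : U x -> U y -> `|x - y|%:E <= diam U.
Proof. by move=> Ux Uy; apply: ereal_sup_ubound; exists x => //; exists y. Qed.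

Lemma diam_le (c : \bar R) U :
  (forall x y, U x -> U y -> `|x - y|%:E <= c) -> diam U <= c.
Proof. by move=> h; apply: ge_ereal_sup => _ [x Ux [y Uy <-]]; exact: h. Qed.

Lemma premeasure_ge0 s d E : 0 <= hausdorff_premeasure s d E.
Proof.
apply: le_ereal_inf_tmp => _ [U _ <-].
by apply: nneseries_ge0 => *; exact: diam_pow_ge0.
Qed.

Lemma premeasure_le_cover s d E (U : nat -> set R) :
  E `<=` \bigcup_i U i -> (forall i, diam (U i) <= d%:E) ->
  hausdorff_premeasure s d E <= \sum_(0 <= i <oo) diam_pow s (U i).
Proof. by move=> EU Ud; apply: ereal_inf_lbound; exists U. Qed.

Lemma premeasure_lt_cover s d E (b : \bar R) : hausdorff_premeasure s d E < b ->
  exists U : nat -> set R, [/\ E `<=` \bigcup_i U i,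
    forall i, diam (U i) <= d%:E & \sum_(0 <= i <oo) diam_pow s (U i) < b].
Proof. by move=> /ereal_inf_lt[_ [U [EU Ud] <-] Ub]; exists U. Qed.

Lemma le_premeasure s d E F : E `<=` F ->
  hausdorff_premeasure s d E <= hausdorff_premeasure s d F.
Proof.
move=> EF; apply: le_ereal_inf_tmp => _ [U [FU Ud] <-].
by apply: premeasure_le_cover => //; exact: subset_trans FU.
Qed.

Lemma le_hausdorff_measure s E F : E `<=` F ->
  hausdorff_measure s E <= hausdorff_measure s F.
Proof.
move=> EF; apply: ge_ereal_sup => _ [d d0 <-].
apply: (le_trans (le_premeasure s d EF)).
by apply: ereal_sup_ubound; exists d.
Qed.

Lemma hausdorff_measure_ge0 s E : 0 <= hausdorff_measure s E.
Proof.
apply: (le_trans (premeasure_ge0 s 1 E)).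
by apply: ereal_sup_ubound; exists 1%R => //=.
Qed.

Lemma le_hausdorff_dim E F : E `<=` F -> hausdorff_dim E <= hausdorff_dim F.
Proof.
move=> EF; apply: le_ereal_inf_tmp => _ [s [s0 sF] <-].
apply: ereal_inf_lbound; exists s => //; split => //.
apply/eqP; rewrite eq_le hausdorff_measure_ge0 andbT.
by rewrite -sF; exact: le_hausdorff_measure.
Qed.

(** Near-optimal covers of the pieces, with errors [e / 2 ^ n.+1], are merged into a single cover
    along a bijection between [nat] and [nat * nat]. *)
Lemma premeasure_bigcup s d (E : nat -> set R) :
  hausdorff_premeasure s d (\bigcup_i E i) <=
  \sum_(0 <= i <oo) hausdorff_premeasure s d (E i).
Proof.
(* A piece of infinite premeasure makes the right side infinite. Otherwise all values are finite, so
   adding a positive error to them gives strict upper bounds. *)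
have [[i ioo]|] := pselect (exists i, hausdorff_premeasure s d (E i) = +oo).
  rewrite (eseries_pinfty _ _ ioo) ?leey// => n _.
  by rewrite -ltNye (lt_le_trans _ (premeasure_ge0 _ _ _)).
rewrite -forallNE => Eoo.
apply/lee_addgt0Pr => e e0.
apply: (le_trans _ (epsilon_trick _ _ _)) => //; last 2 first.
- by move=> n; exact: premeasure_ge0.
- exact: ltW.
pose P n (V : nat -> set R) := [/\ E n `<=` \bigcup_i V i,
  forall i, diam (V i) <= d%:E & \sum_(0 <= i <oo) diam_pow s (V i) <
    hausdorff_premeasure s d (E n) + (e / (2 ^ n.+1)%:R)%:E].
have [G PG] : {G : nat -> nat -> set R & forall n, P n (G n)}.
  apply: (@choice _ _ P) => n; apply: premeasure_lt_cover.
  rewrite lteDl; first by rewrite lte_fin divr_gt0.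
  rewrite ge0_fin_numE ?premeasure_ge0// ltey.
  by apply/eqP; exact: Eoo.
have /card_esym/ppcard_eqP[f] := card_nat2.
have G0 x : 0 <= (diam_pow s \o uncurry G) x by exact: diam_pow_ge0.
apply: (@le_trans _ _ (\sum_(0 <= i <oo) \sum_(0 <= j <oo) diam_pow s (G i j)));
  last first.
  apply: lee_nneseries => [*|i _]; last by case: (PG i) => _ _ /ltW.
  by apply: nneseries_ge0 => *; exact: diam_pow_ge0.
rewrite nneseries_esumT; last first.
  by move=> n; apply: nneseries_ge0 => *; exact: diam_pow_ge0.
rewrite (eq_esum (b := fun i => \esum_(j in [set: nat]) diam_pow s (G i j)));
  last by move=> i _; rewrite nneseries_esumT// => *; exact: diam_pow_ge0.
rewrite esum_esum; last by move=> *; exact: diam_pow_ge0.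
rewrite (_ : [set: nat] `*`` (fun=> [set: nat]) = [set: nat * nat]); last first.
  by apply/seteqP; split.
rewrite (@reindex_esum R _ _ [set: nat] _ f); last exact: bij.
rewrite -nneseries_esumT; last by move=> *; exact: diam_pow_ge0.
apply: premeasure_le_cover.
  move=> x [n _ Enx]; case: (PG n) => /(_ x Enx)[m _ Gx] _ _.
  by exists (f^-1%FUN (n, m)) => //=; rewrite invK ?inE.
by move=> i; case: (PG (f i).1).
Qed.

Lemma premeasure_bigcup_eq0 s d (E : nat -> set R) :
  (forall i, hausdorff_premeasure s d (E i) = 0) ->
  hausdorff_premeasure s d (\bigcup_i E i) = 0.
Proof.
move=> E0; apply/eqP; rewrite eq_le premeasure_ge0 andbT.
apply: (le_trans (premeasure_bigcup _ _ _)).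
by rewrite eseries0// => *; exact: E0.
Qed.

(* [c <= 1] keeps the image of a cover admissible for the same [d]. *)
Lemma premeasure_lipschitz s d E (c : R) (f : R -> R) : (0 <= s)%R ->
  (0 < c <= 1)%R ->
  (forall x y, `|f x - f y| <= c * `|x - y|)%R ->
  hausdorff_premeasure s d (f @` E) <= (c `^ s)%:E * hausdorff_premeasure s d E.
Proof.
move=> s0 /andP[c0 c1] fc.
have cs0 : (0 < c `^ s)%R by exact: powR_gt0.
rewrite -lee_pdivrMl//; apply: le_ereal_inf_tmp => _ [U [EU Ud] <-].
rewrite lee_pdivrMl// -nneseriesZl; last by move=> k _; exact: diam_pow_ge0.
have dfU (V : set R) : V !=set0 -> diam (f @` V) <= c%:E * diam V.
  move=> V0; apply: diam_le => _ _ [x Vx <-] [y Vy <-].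
  apply: (@le_trans _ _ (c * `|x - y|)%:E); first by rewrite lee_fin.
  by rewrite EFinM lee_pmul2l//; exact: le_diam.
apply: (@le_trans _ _ (\sum_(0 <= i <oo) diam_pow s (f @` U i))).
  apply: premeasure_le_cover.
    by move=> _ [x Ex <-]; have [i _ Ux] := EU x Ex; exists i => //; exists x.
  move=> i; have [->|/set0P Ui0] := eqVneq (U i) set0.
    by rewrite image_set0 /diam; apply: ge_ereal_sup => ? [? []].
  apply: (le_trans (dfU _ Ui0)); apply: (le_trans _ (Ud i)).
  by rewrite gee_pMl// ?diam_ge0//= lee_fin.
apply: lee_nneseries => [*|i _]; first exact: diam_pow_ge0.
have [->|/set0P Ui0] := eqVneq (U i) set0.
  by rewrite image_set0 !diam_pow_set0 mule0.
have fUi0 : f @` U i !=set0 by case: Ui0 => x Ux; exists (f x); exists x.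
rewrite !diam_pow_neq0//.
have dUi0 := diam_ge0 Ui0.
rewrite -poweR_EFin -poweRM// ?lee_fin ?(ltW c0)//.
by apply: gt0_ler_poweR => //; rewrite ?in_itv/= ?leey ?andbT ?diam_ge0 ?dfU//
  mule_ge0// lee_fin ltW.
Qed.

(** One scale suffices: since [s > 0], a cover of small total weight consists of sets of small
    diameter, so it is admissible at every finer scale as well. *)
Lemma premeasure_eq0_hausdorff s d E : (0 < s)%R -> (0 < d)%R ->
  hausdorff_premeasure s d E = 0 -> hausdorff_measure s E = 0.
Proof.
move=> s0 d0 E0; apply/eqP; rewrite eq_le hausdorff_measure_ge0 andbT.
apply: ge_ereal_sup => _ [r r0 <-]; apply/lee_addgt0Pr => e e0; rewrite add0e.
have rs0 : (0 < r `^ s)%R by exact: powR_gt0.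
(* The bound [e] is for the total weight; the other one forces each diameter to be at most [r]. *)
have : hausdorff_premeasure s d E < (Num.min e (r `^ s))%:E.
  by rewrite E0 lte_fin lt_min e0.
move=> /premeasure_lt_cover[U [EU _ Ue]].
have dU i : diam_pow s (U i) <= (r `^ s)%:E.
  apply: (@le_trans _ _ (\sum_(0 <= i <oo) diam_pow s (U i))).
    rewrite (@nneseriesD1 R _ i)//; last by move=> *; exact: diam_pow_ge0.
    by rewrite leeDl//; apply: nneseries_ge0 => *; exact: diam_pow_ge0.
  by apply: (le_trans (ltW Ue)); rewrite lee_fin ge_min lexx orbT.
apply: (@le_trans _ _ (\sum_(0 <= i <oo) diam_pow s (U i))); last first.
  by apply: (le_trans (ltW Ue)); rewrite lee_fin ge_min lexx.
apply: premeasure_le_cover => // i.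
have [->|/set0P Ui0] := eqVneq (U i) set0.
  by rewrite /diam; apply: ge_ereal_sup => ? [? []].
have := dU i; rewrite diam_pow_neq0// => dUi.
have s10 : (0 <= s^-1)%R by rewrite invr_ge0 ltW.
rewrite -(poweRe1 (diam_ge0 Ui0)) -(@mulfV _ s) ?gt_eqF// poweRrM.
have -> : r%:E = (r `^ s)%:E `^ (s^-1).
  by rewrite poweR_EFin -powRrM mulfV ?gt_eqF// powRr1// ltW.
by apply: gt0_ler_poweR => //; rewrite ?in_itv/= ?leey ?andbT ?poweR_ge0// lee_fin ltW.
Qed.

End HausdorffFacts.

(** * Endpoints, lengths and tails of the cells *)

Section Cells.
Context {R : realType}.
Variable A : nat -> set R.
Hypothesis hA : luroth_partition A.

Lemma cell_ends : exists u v : nat -> R,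
  forall n, (0 < n)%N -> u n < v n /\ A n = `]u n, v n]%classic.
Proof.
have [f hf] : {f : nat -> R * R & forall n, (0 < n)%N ->
    (f n).1 < (f n).2 /\ A n = `](f n).1, (f n).2]%classic}.
  apply: (@choice _ _ (fun n (p : R * R) => (0 < n)%N ->
    p.1 < p.2 /\ A n = `]p.1, p.2]%classic)) => n.
  have [n0|] := posnP n; first by exists (0, 0) => /[!n0].
  by move=> /(luroth_partition_itv hA)[u [v uv]]; exists (u, v).
by exists (fun n => (f n).1), (fun n => (f n).2).
Qed.

(** The ordering forbids overlaps and the covering forbids gaps, so consecutive cells share an
    endpoint. *)
Lemma decreasing_cell_ends : exists v : nat -> R, [/\ v 1%N = 1,
  forall n, (0 < n)%N -> [/\ 0 < v n, v n.+1 < v n &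
    A n = `]v n.+1, v n]%classic] & v @ \oo --> 0].
Proof.
have [u [v uv]] := cell_ends.
have Av n : (0 < n)%N -> A n (v n).
  by move=> n0; have [uvn ->] := uv n n0; rewrite /= in_itv/= uvn lexx.
have sub n x : (0 < n)%N -> A n x -> 0 < x <= 1.
  move=> n0 Anx.
  have : (\bigcup_(n in [set n | (0 < n)%N]) A n) x by exists n.
  by rewrite (luroth_partition_cover hA)/= in_itv.
have cov x : 0 < x <= 1 -> exists2 n, (0 < n)%N & A n x.
  move=> x01; have : (\bigcup_(n in [set n | (0 < n)%N]) A n) x.
    by rewrite (luroth_partition_cover hA)/= in_itv.
  by move=> [n n0 Anx]; exists n.
have ord := luroth_partition_order hA.
have mid n : (0 < n)%N -> forall w, u n < w -> w <= v n -> A n w.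
  by move=> n0 w uw wv; have [_ ->] := uv n n0; rewrite /= in_itv/= uw.
have v1 : v 1%N = 1.
  have [|m m0 Am1] := cov 1; first by rewrite ltr01 lexx.
  have /andP[_ v1le] := sub _ _ (ltn0Sn 0) (Av 1%N isT).
  move: m m0 Am1 => [//|[|m]] _ Am1.
    have [_ e] := uv 1%N isT.
    by move: Am1; rewrite e/= in_itv/= => /andP[_ le1]; apply/eqP; rewrite eq_le v1le.
  by have := ord 1%N m.+2 _ _ isT isT (Av 1%N isT) Am1; lra.
have vu n : (0 < n)%N -> v n.+1 = u n.
  move=> n0; have [uvn An] := uv n n0.
  have le1 : v n.+1 <= u n.
    rewrite leNgt; apply/negP => lt1.
    have Anw : A n (Num.min (v n) (v n.+1)).
      by apply: mid => //; [rewrite lt_min uvn | rewrite ge_min lexx].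
    have := ord _ _ _ _ n0 (ltnSn n) Anw (Av n.+1 isT).
    by rewrite lt_min ltxx andbF.
  (* A gap [v n.+1 < u n] is impossible: the cell [m] holding [u n] is not [A n], which is
     left-open, and any other [m] contradicts the ordering or the right end of [A n.+1]. *)
  apply/eqP; rewrite eq_le le1/= leNgt; apply/negP => lt1.
  have [|m m0 Amu] := cov (u n).
    have /andP[vn10 _] := sub n.+1 _ isT (Av n.+1 isT).
    have /andP[_ vn1] := sub _ _ n0 (Av n n0).
    by rewrite (lt_trans vn10 lt1) (le_trans (ltW uvn) vn1).
  have [mn|mn|mn] := ltngtP m n.
  - by have := ord _ _ _ _ m0 mn Amu (Av n n0); lra.
  - have [mn1|mn1] := eqVneq m n.+1.
      by move: Amu; rewrite mn1; have [_ ->] := uv n.+1 isT; rewrite /= in_itv/=; lra.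
    have := ord n.+1 m _ _ isT _ (Av n.+1 isT) Amu.
    by rewrite ltn_neqAle eq_sym mn1 => /(_ mn); lra.
  - by move: Amu; rewrite mn An/= in_itv/= ltxx.
exists v; split => //.
  move=> n n0; have [uvn An] := uv n n0.
  by rewrite vu//; split => //; have /andP[] := sub _ _ n0 (Av n n0).
(* The shift skips [v 0], which is arbitrary. *)
have vdec : {homo (fun n => v n.+1) : n m / (n <= m)%N >-> m <= n}.
  apply: homo_leq => [//|y x z xy yz|n]; first exact: le_trans yz xy.
  by rewrite vu// ltW//; have [] := uv n.+1 isT.
have vlb : has_lbound (range (fun n => v n.+1)).
  exists 0 => _ [n _ <-]; apply: ltW.
  by have /andP[] := sub n.+1 _ isT (Av n.+1 isT).
have cv := nonincreasing_is_cvgn vdec vlb.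
rewrite -(cvg_shiftS v).
suff l0 : limn (fun n => v n.+1) = 0 by rewrite l0 in cv.
set l := limn _.
have lv n : l <= v n.+1 by exact: nonincreasing_cvgn_ge.
have l0 : 0 <= l.
  apply: limr_ge => //; apply: nearW => n; apply: ltW.
  by have /andP[] := sub n.+1 _ isT (Av n.+1 isT).
(* A positive limit [l] would lie in some [A m], although [v m.+1], a point of the next cell, is at
   least [l]. *)
apply/eqP; rewrite eq_le l0 andbT leNgt; apply/negP => lgt0.
have [|m m0 Aml] := cov l; first by rewrite lgt0 -v1 lv.
have := ord m m.+1 _ _ m0 (ltnSn _) Aml (Av m.+1 isT).
by rewrite ltNge lv.
Qed.

(** The partial sums of [cell_length] telescope to [v n - v N], and [v N] tends to 0; this
    identifies the limit in [cell_tail] with an endpoint. *)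
Lemma cell_tail_ends : exists2 v : nat -> R, [/\ v 1%N = 1,
  forall n, (0 < n)%N -> [/\ 0 < v n, v n.+1 < v n,
    A n = `]v n.+1, v n]%classic & cell_length A n = v n - v n.+1]
  & v @ \oo --> 0] & forall n, (0 < n)%N -> cell_tail A n = v n.
Proof.
have [v [v1 vA v0]] := decreasing_cell_ends.
have len k : (0 < k)%N -> cell_length A k = v k - v k.+1.
  move=> k0; have [_ vk Ak] := vA k k0.
  by rewrite /cell_length Ak lebesgue_measure_itv/= lte_fin vk.
exists v; first by split => // n n0; have [? ? ?] := vA n n0; split => //; exact: len.
move=> n n0; apply/cvg_lim => //.
have cv : v n - v N @[N --> \oo] --> v n.
  by rewrite -[X in _ --> X]subr0; apply: cvgB => //; exact: cvg_cst.
apply: cvg_trans cv; apply: near_eq_cvg; near=> N.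
have nN : (n <= N)%N by near: N; exists n.
rewrite -opprB -(telescope_sumr v nN) -sumrN big_nat_cond [RHS]big_nat_cond.
apply: eq_bigr => i /andP[/andP[ni _] _].
by rewrite len ?opprB// (leq_trans n0).
Unshelve. all: by end_near. Qed.

Lemma cellE n : (0 < n)%N -> A n = `]cell_tail A n.+1, cell_tail A n]%classic.
Proof.
by have [v [_ vA _] tv] := cell_tail_ends => n0; rewrite !tv//; have [] := vA n n0.
Qed.

Lemma cell_lengthE n : (0 < n)%N ->
  cell_length A n = cell_tail A n - cell_tail A n.+1.
Proof.
by have [v [_ vA _] tv] := cell_tail_ends => n0; rewrite !tv//; have [] := vA n n0.
Qed.

Lemma cell_tail_gt0 n : (0 < n)%N -> 0 < cell_tail A n.
Proof.
by have [v [_ vA _] tv] := cell_tail_ends => n0; rewrite !tv//; have [] := vA n n0.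
Qed.

Lemma cell_tail_ltS n : (0 < n)%N -> cell_tail A n.+1 < cell_tail A n.
Proof.
by have [v [_ vA _] tv] := cell_tail_ends => n0; rewrite !tv//; have [] := vA n n0.
Qed.

Lemma cell_tail1 : cell_tail A 1 = 1.
Proof. by have [v [v1 _ _] tv] := cell_tail_ends; rewrite tv. Qed.

Lemma cvg_cell_tail : cell_tail A @ \oo --> 0.
Proof.
have [v [_ _ v0] tv] := cell_tail_ends.
apply: cvg_trans v0; apply: near_eq_cvg; near=> n; rewrite tv//.
by near: n; exists 1%N.
Unshelve. all: by end_near. Qed.

Lemma cell_length_gt0 n : (0 < n)%N -> 0 < cell_length A n.
Proof. by move=> n0; rewrite cell_lengthE// subr_gt0 cell_tail_ltS. Qed.

Lemma cell_tail_le m n : (0 < m)%N -> (m <= n)%N -> cell_tail A n <= cell_tail A m.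
Proof.
move=> m0 /subnKC <-; elim: (n - m)%N => [|k]; first by rewrite addn0.
by apply: le_trans; rewrite addnS ltW// cell_tail_ltS// addn_gt0 m0.
Qed.

Lemma cell_tail_le1 n : (0 < n)%N -> cell_tail A n <= 1.
Proof. by move=> n0; rewrite -cell_tail1 cell_tail_le. Qed.

Lemma cell_length_le1 n : (0 < n)%N -> cell_length A n <= 1.
Proof.
move=> n0; rewrite cell_lengthE//.
by have := cell_tail_le1 n0; have := @cell_tail_gt0 n.+1 isT; lra.
Qed.

Lemma cell_indexE n x : (0 < n)%N -> cell_tail A n.+1 < x <= cell_tail A n ->
  cell_index A x = n.
Proof.
move=> n0 xn; apply: xget_unique.
  by split => //; rewrite cellE//= in_itv.
move=> m [m0 Amx]; apply/eqP; case: ltngtP => // mn.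
  have := luroth_partition_order hA m0 mn Amx.
  by rewrite cellE// => /(_ x)/=; rewrite in_itv/= xn ltxx => /(_ isT).
have := luroth_partition_order hA n0 mn _ Amx.
by rewrite cellE// => /(_ x)/=; rewrite in_itv/= xn ltxx => /(_ isT).
Qed.

Lemma cell_indexP x : 0 < x <= 1 -> let n := cell_index A x in
  (0 < n)%N /\ cell_tail A n.+1 < x <= cell_tail A n.
Proof.
have : (\bigcup_(n in [set n | (0 < n)%N]) A n) x -> exists n, (0 < n)%N /\ A n x.
  by case=> n; exists n.
rewrite (luroth_partition_cover hA)/= in_itv/= => h /h.
move=> /(@xgetPex _ 0%N [set n | (0 < n)%N /\ A n x])[n0].
by rewrite cellE//= in_itv.
Qed.

End Cells.

(** * The ratio test *)

Section RatioTest.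
Context {R : realType}.
Implicit Types (u : nat -> R) (r : R) (K m : nat).

Lemma ratio_sum_le u r K m : r < 1 -> (forall k, 0 <= u k) ->
  (forall k, (K <= k)%N -> u k.+1 <= r * u k) ->
  \sum_(0 <= i < m) u (K + i)%N <= u K / (1 - r).
Proof.
move=> r1 u0 ur; have q0 : 0 < 1 - r by rewrite subr_gt0.
(* Keeping [u (K + m) / (1 - r)], a bound for the remaining terms, lets the induction close. *)
suff : \sum_(0 <= i < m) u (K + i)%N + u (K + m)%N / (1 - r) <= u K / (1 - r).
  by apply: le_trans; rewrite lerDl divr_ge0// ltW.
elim: m => [|m IH]; first by rewrite big_nil add0r addn0.
rewrite big_nat_recr//=; apply: le_trans IH; rewrite -addrA lerD2l addnS.
rewrite -(ler_pM2r q0) mulrDl !divfK ?gt_eqF//.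
by have := ur (K + m)%N (leq_addr _ _); lra.
Qed.

Lemma ratio_cvg0 u r K : 0 <= r -> r < 1 -> (forall k, 0 <= u k) ->
  (forall k, (K <= k)%N -> u k.+1 <= r * u k) -> u @ \oo --> 0.
Proof.
move=> r0 r1 u0 ur.
have ub m : u (m + K)%N <= u K * r ^+ m.
  elim: m => [|m IH]; first by rewrite expr0 mulr1.
  rewrite addSn (le_trans (ur _ (leq_addl _ _)))// exprS mulrCA.
  exact: ler_wpM2l.
rewrite -(cvg_shiftn K).
apply: (squeeze_cvgr _ (cvg_cst 0) (cvg_geometric (u K) _)).
  by apply: nearW => m; apply/andP; split; [exact: u0 | exact: ub].
by rewrite ger0_norm.
Qed.

Lemma powR_lt1 (b e : R) : 1 < b -> e < 0 -> b `^ e < 1.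
Proof.
move=> b1 e0; rewrite lt_neqAle powR_eq1 !negb_or gt_eqF// -leNgt lt_eqF//=.
apply/andP; split; first by rewrite (le_trans ler01 (ltW b1)).
by have := @ler_powR R b (ltW b1) _ _ (ltW e0); rewrite powRr0.
Qed.

End RatioTest.

(** * Asymptotics of cell lengths and tails along powers of 2 *)

Section CellAsymptotics.
Context {R : realType}.
Variables (A : nat -> set R) (theta : R).
Hypothesis hA : luroth_partition A.
Hypothesis hexp : expansive A theta.
Hypothesis hdec : eventually_decreasing A.

Let t := cell_tail A.
Let a := cell_length A.

(** Slow variation at the factor 2 makes the quotient of the [psi] values tend to 1; the power of
    [n] contributes the limit. *)
Lemma cvg_tail_ratio : t (2 * n)%N / t n @[n --> \oo] --> 2 `^ (- theta).
Proof.
have [psi [f [mf f0 fsv psif]] tpsi] := hexp.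
have h2 : f (n%:R * 2) / f n%:R @[n --> \oo] --> (1 : R).
  exact: (cvg_comp (fun n : nat => n%:R : R) _ cvgr_idn (fsv 2 (ltr0n _ 2))).
have h3 : (f (n%:R * 2) / f n%:R) * 2 `^ (- theta) @[n --> \oo] --> 2 `^ (- theta).
  by rewrite -[X in _ --> X]mul1r; apply: cvgM => //; exact: cvg_cst.
apply: cvg_trans h3; apply: near_eq_cvg; near=> n.
have n0 : (0 < n)%N by near: n; exists 1%N.
have nR : 0 < n%:R :> R by rewrite ltr0n.
rewrite /t !tpsi ?muln_gt0// !psif ?muln_gt0// natrM powRM ?ltW//.
rewrite (mulrC 2 n%:R).
have := f0 _ nR; have := powR_gt0 (- theta) nR.
by move=> p q; field; rewrite !gt_eqF.
Unshelve. all: by end_near. Qed.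

(** The limit of the ratio lies strictly between the two powers of 2; [eta] is the slack later spent
    in the ratio test. *)
Lemma near_dyadic_tail (eta : R) : 0 < eta -> exists K, forall k, (K <= k)%N ->
  2 `^ (- theta - eta) * t (2 ^ k) <= t (2 ^ k.+1) <= 2 `^ (- theta + eta) * t (2 ^ k).
Proof.
move=> eta0.
have b1 : 1 < 2 :> R by lra.
have pw e e' : e < e' -> (2:R) `^ e < 2 `^ e'.
  move=> ee; rewrite -(ltr_pM2r (@powR_gt0 R 2 (- e') _))// -!powRD ?pnatr_eq0 ?implybT//.
  by rewrite subrr powRr0; apply: powR_lt1 => //; lra.
have e1 : - theta < - theta + eta by rewrite ltrDl.
have e2 : - theta - eta < - theta by rewrite gtrBl.
have [N2 _ hN2] := cvgr_le _ cvg_tail_ratio _ (pw _ _ e1).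
have [N1 _ hN1] := cvgr_ge _ cvg_tail_ratio _ (pw _ _ e2).
exists (N1 + N2)%N => k Kk.
have k2 : (k <= 2 ^ k)%N by apply: ltnW; exact: ltn_expl.
have tk : 0 < t (2 ^ k) by apply: cell_tail_gt0 => //; rewrite expn_gt0.
rewrite expnS; apply/andP; split.
  rewrite -ler_pdivlMr//; apply: hN1 => /=.
  by apply: leq_trans k2; apply: leq_trans Kk; exact: leq_addr.
rewrite -ler_pdivrMr//; apply: hN2 => /=.
by apply: leq_trans k2; apply: leq_trans Kk; exact: leq_addl.
Qed.

Lemma near_cell_length_decreasing :
  exists N, forall m n, (N <= m)%N -> (m <= n)%N -> a n <= a m.
Proof.
have [N _ hN] := hdec; exists N => m n Nm /subnKC <-.
elim: (n - m)%N => [|k]; first by rewrite addn0.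
apply: le_trans; rewrite addnS ltW//; apply: (hN (m + k).+1) => /=.
by rewrite leqW// (leq_trans Nm)// leq_addr.
Qed.

(** The [n] cells from [n] to [2 * n - 1] have total length below [t n], and each is at least as
    long as the cell [2 * n]. *)
Lemma near_cell_length_le : exists2 N, (0 < N)%N &
  forall n, (N <= n)%N -> a (2 * n) <= t n / n%:R.
Proof.
have [N hN] := near_cell_length_decreasing.
exists N.+1 => // n Nn; have n0 : (0 < n)%N by exact: leq_trans Nn.
rewrite ler_pdivlMr ?ltr0n//.
have h i : (i <= n)%N -> a (2 * n) * i%:R <= t n - t (n + i).
  elim: i => [|i IH] il; first by rewrite mulr0 addn0 subrr.
  have := IH (ltnW il); rewrite addnS -natr1 mulrDr mulr1.
  have : a (2 * n) <= a (n + i).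
    apply: hN; first by rewrite (leq_trans (ltnW Nn))// leq_addr.
    by rewrite mul2n -addnn leq_add2l ltnW.
  rewrite {2}/a cell_lengthE ?addn_gt0 ?n0// -/t; lra.
apply: le_trans (h n (leqnn _)) _; rewrite gerBl ltW//.
by rewrite cell_tail_gt0// addn_gt0 n0.
Qed.

(** For large [k], a majorant of all cell lengths from index [2 ^ k.+1] on: the bound [t n / n] at
    [n = 2 ^ k]. *)
Let u k : R := t (2 ^ k) / 2 ^+ k.

Let tgt0 k : 0 < t (2 ^ k).
Proof. by apply: cell_tail_gt0 => //; rewrite expn_gt0. Qed.

Let ugt0 k : 0 < u k.
Proof. by rewrite divr_gt0// exprn_gt0. Qed.

Lemma near_dyadic_length : exists K, forall k n,
  (K <= k)%N -> (2 ^ k.+1 <= n)%N -> a n <= u k.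
Proof.
have [N hN] := near_cell_length_decreasing.
have [M M0 hM] := near_cell_length_le.
exists (N + M)%N => k n Kk kn.
have k2 : (k < 2 ^ k)%N by exact: ltn_expl.
apply: (@le_trans _ _ (a (2 ^ k.+1))).
  by apply: hN => //; rewrite expnS; lia.
by rewrite expnS /u -natrX; apply: hM; lia.
Qed.

Lemma near_u_ratio (eta : R) : 0 < eta -> exists K, forall k, (K <= k)%N ->
  u k.+1 <= 2 `^ (- theta - 1 + eta) * u k.
Proof.
move=> /near_dyadic_tail[K hK]; exists K => k /hK/andP[_ tk].
rewrite /u ler_pdivrMr ?exprn_gt0//.
have -> : - theta - 1 + eta = (- theta + eta) - 1 by ring.
rewrite powRD ?pnatr_eq0 ?implybT// powR_inv1// exprS.
apply: (le_trans tk); rewrite le_eqVlt; apply/orP; left; apply/eqP.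
have p : 0 < (2:R) ^+ k by rewrite exprn_gt0.
by field; rewrite gt_eqF.
Qed.

(** Condensation: the block from [2 ^ k.+1] to [2 ^ k.+2] has [2 ^ k.+1] terms, each at most the
    [s]-th power of [u k] for large [k], and the block bounds [c k] pass the ratio test. *)
Lemma sum_cell_length_powR (s : R) : 0 <= theta -> (1 + theta)^-1 < s ->
  exists2 N, (0 < N)%N & forall M, \sum_(N <= n < M) a n `^ s <= 2^-1.
Proof.
move=> th0 hs; have th1 : 0 < 1 + theta by rewrite ltr_wpDr.
have s0 : 0 < s by apply: lt_trans hs; rewrite invr_gt0.
have hs1 : 1 < s * (1 + theta) by rewrite -ltr_pdivrMr// mul1r.
(* With this slack the exponent of 2 in [r] is [(1 - s * (1 + theta)) / 2], which is negative. *)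
pose eta := (s * (1 + theta) - 1) / (2 * s).
have eta0 : 0 < eta by rewrite divr_gt0// ?mulr_gt0// subr_gt0.
have [K1 hK1] := near_u_ratio eta0.
have [K2 hK2] := near_dyadic_length.
pose r : R := 2 `^ (1 + (- theta - 1 + eta) * s).
have r1 : r < 1.
  apply: powR_lt1; first by lra.
  have -> : 1 + (- theta - 1 + eta) * s = (1 - s * (1 + theta)) / 2.
    by rewrite /eta; field; rewrite gt_eqF.
  by lra.
have r0 : 0 <= r by exact: powR_ge0.
pose c k : R := 2 ^+ k.+1 * u k `^ s.
have c0 k : 0 <= c k by rewrite mulr_ge0// ?exprn_ge0// powR_ge0.
have cr k : (K1 <= k)%N -> c k.+1 <= r * c k.
  move=> Kk; have := @ge0_ler_powR R s (ltW s0) (u k.+1) _ _ _ (hK1 k Kk).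
  rewrite !nnegrE (ltW (ugt0 _)) => /(_ isT).
  rewrite mulr_ge0 ?powR_ge0 ?(ltW (ugt0 _))// => /(_ isT).
  rewrite powRM ?powR_ge0 ?(ltW (ugt0 _))// -powRrM => h.
  rewrite /c /r powRD ?pnatr_eq0 ?implybT// powRr1// exprS -!mulrA.
  rewrite ler_pM2l// mulrCA ler_pM2l ?exprn_gt0//.
(* The geometric tail starting at [c K] is at most [c K / (1 - r)], hence the threshold. *)
have [K3 _ hK3] : \forall k \near \oo, c k <= (1 - r) / 2.
  by apply: (cvgr_le _ (ratio_cvg0 r0 r1 c0 cr) _); rewrite divr_gt0// subr_gt0.
pose K := (K1 + K2 + K3)%N.
have block k : (K <= k)%N -> \sum_(2 ^ k.+1 <= n < 2 ^ k.+2) a n `^ s <= c k.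
  move=> Kk; apply: (@le_trans _ _ (\sum_(2 ^ k.+1 <= n < 2 ^ k.+2) u k `^ s)).
    apply: ler_sum_nat => n /andP[kn _].
    have n0 : (0 < n)%N by apply: leq_trans kn; rewrite expn_gt0.
    have an := cell_length_gt0 hA n0.
    apply: ge0_ler_powR; rewrite ?nnegrE ?(ltW s0) ?(ltW (ugt0 _)) ?(ltW an)//.
    by apply: hK2 => //; move: Kk; rewrite /K; lia.
  rewrite sumr_const_nat -mulr_natl /c -natrX.
  by rewrite (_ : (2 ^ k.+2 - 2 ^ k.+1)%N = (2 ^ k.+1)%N)//; rewrite !expnS; lia.
have blocks m : \sum_(2 ^ K.+1 <= n < 2 ^ (K + m).+1) a n `^ s <=
    \sum_(0 <= i < m) c (K + i)%N.
  elim: m => [|m IH]; first by rewrite addn0 !big_geq.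
  rewrite big_nat_recr//= (@big_cat_nat _ _ _ (2 ^ (K + m).+1))//=; last 2 first.
  - by rewrite leq_exp2l// ltnS leq_addr.
  - by rewrite leq_exp2l// ltnS leq_add2l.
  by apply: lerD => //; rewrite addnS; apply: block; exact: leq_addr.
exists (2 ^ K.+1)%N => [|M]; first by rewrite expn_gt0.
have [MK|KM] := leqP M (2 ^ K.+1); first by rewrite big_geq// invr_ge0.
have MM : (M <= 2 ^ (K + M).+1)%N.
  apply: (@leq_trans (2 ^ M)); first by rewrite ltnW// ltn_expl.
  by rewrite leq_exp2l// leqW// leq_addl.
apply: (@le_trans _ _ (\sum_(2 ^ K.+1 <= n < 2 ^ (K + M).+1) a n `^ s)).
  rewrite [leRHS](@big_cat_nat _ _ _ M)//=; last exact: ltnW.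
  by rewrite lerDl sumr_ge0// => *; exact: powR_ge0.
apply: (le_trans (blocks M)); apply: (le_trans (ratio_sum_le _ r1 c0 _)).
  by move=> k Kk; apply: cr; move: Kk; rewrite /K; lia.
rewrite ler_pdivrMr ?subr_gt0// mulrC.
by apply: hK3; rewrite /K/=; lia.
Qed.

(** Inside a dyadic block, [a n] is at most [u k] and [t n.+1] at least [t (2 ^ k.+2)]; the
    resulting quotients [c k] tend to 0 by the ratio test. *)
Lemma near_cell_length_tail (s : R) : 0 <= theta -> 0 <= s -> s < (1 + theta)^-1 ->
  \forall n \near \oo, a n `^ (1 - s) <= t n.+1.
Proof.
move=> th0 s0 hs; have th1 : 0 < 1 + theta by rewrite ltr_wpDr.
have hs1 : s * (1 + theta) < 1 by rewrite -ltr_pdivlMr// mul1r.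
have sle1 : s <= 1 by nra.
(* With this slack [e1 - e2] equals [- (2 + s) * eta], which is negative. *)
pose eta := (1 - s * (1 + theta)) / 4.
have eta0 : 0 < eta by rewrite divr_gt0// subr_gt0.
have [K1 hK1] := near_u_ratio eta0.
have [K2 hK2] := near_dyadic_length.
have [K3 hK3] := near_dyadic_tail eta0.
pose e1 := (- theta - 1 + eta) * (1 - s); pose e2 := - theta - eta.
pose r : R := 2 `^ (e1 - e2).
have r1 : r < 1.
  apply: powR_lt1; first by lra.
  by rewrite /e1 /e2 /eta; nra.
have r0 : 0 <= r by exact: powR_ge0.
pose c k : R := u k `^ (1 - s) / t (2 ^ k.+2).
have c0 k : 0 <= c k by rewrite divr_ge0// ?powR_ge0// ltW.
have cr k : (K1 + K3 <= k)%N -> c k.+1 <= r * c k.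
  move=> Kk; have hk1 : (K1 <= k)%N by lia.
  have := @ge0_ler_powR R (1 - s) _ (u k.+1) _ _ _ (hK1 k hk1).
  rewrite subr_ge0 => /(_ sle1).
  rewrite !nnegrE (ltW (ugt0 _)) => /(_ isT).
  rewrite mulr_ge0 ?powR_ge0 ?(ltW (ugt0 _))// => /(_ isT).
  rewrite powRM ?powR_ge0 ?(ltW (ugt0 _))// -powRrM -/e1 => h.
  have hk3 : (K3 <= k.+2)%N by lia.
  have /andP[h3 _] := hK3 _ hk3.
  rewrite /c ler_pdivrMr//.
  apply: (le_trans h); rewrite /r (@powRD _ 2) ?pnatr_eq0 ?implybT// powRN.
  set p := 2 `^ e1; set q := 2 `^ e2 in h3 *.
  have p0 : 0 < p by exact: powR_gt0.
  have q0 : 0 < q by exact: powR_gt0.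
  have w0 : 0 < u k `^ (1 - s) by exact: powR_gt0.
  set T := t (2 ^ k.+2) in h3 *; set T' := t (2 ^ k.+3) in h3 *.
  have T0 : 0 < T by exact: tgt0.
  have -> : p / q * (u k `^ (1 - s) / T) * T' = p * u k `^ (1 - s) * (T' / (q * T)).
    by field; rewrite !gt_eqF.
  by rewrite ler_pMr ?mulr_gt0// ler_pdivlMr ?mulr_gt0// mul1r.
have [K4 _ hK4] : \forall k \near \oo, c k <= 1.
  by apply: (cvgr_le _ (ratio_cvg0 r0 r1 c0 cr) _).
pose K := (K2 + K4)%N.
exists (2 ^ K.+1)%N => // n /= Kn.
have n0 : (0 < n)%N by apply: leq_trans Kn; rewrite expn_gt0.
(* Here [l] becomes [k.+1]; the strict bound [n < 2 ^ k.+2] still gives [n.+1 <= 2 ^ k.+2]. *)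
have /andP[] := trunc_log_bounds (isT : (1 < 2)%N) n0.
set l := trunc_log 2 n => ln nl.
have Kl : (K < l)%N.
  by rewrite -ltnS -(@ltn_exp2l 2)//; exact: leq_ltn_trans nl.
case: l ln nl Kl => // k kn nk; rewrite ltnS => Kk.
have /hK4 : (K4 <= k)%N by move: Kk; rewrite /K; lia.
rewrite /c ler_pdivrMr// mul1r => h.
have an := cell_length_gt0 hA n0.
apply: (@le_trans _ _ (u k `^ (1 - s))).
  apply: ge0_ler_powR; rewrite ?nnegrE ?subr_ge0 ?(ltW (ugt0 _)) ?(ltW an)//.
  by apply: hK2 => //; move: Kk; rewrite /K; lia.
by apply: (le_trans h); apply: cell_tail_le.
Qed.

End CellAsymptotics.

(** * Upper bound for the dimension of [G_infty] *)

Section UpperBound.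
Context {R : realType}.
Variable A : nat -> set R.
Hypothesis hA : luroth_partition A.

Let t := cell_tail A.
Let a := cell_length A.

(** Inverse of [luroth_map] on the cell [n], extended affinely to the whole line. *)
Definition luroth_branch n (x : R) : R := t n - a n * x.

Lemma luroth_map_branch x : 0 < x <= 1 ->
  x = luroth_branch (cell_index A x) (luroth_map A x) /\ 0 <= luroth_map A x <= 1.
Proof.
move=> /(cell_indexP hA)[]; rewrite /luroth_branch /luroth_map -/t -/a.
set n := cell_index A x => n0 /andP[xl xr]; rewrite gt_eqF// mulrC divfK; last first.
  by rewrite gt_eqF// cell_length_gt0.
split; first by rewrite opprB addrC subrK.
have an : 0 < a n by exact: cell_length_gt0.
rewrite divr_ge0 ?subr_ge0 ?(ltW an)//= ler_pdivrMr// mul1r /a cell_lengthE//.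
by rewrite lerD2l lerN2 ltW.
Qed.

(** The first [m] digits are free, so for each [N] these sets cover [G_infty] as [m] varies. *)
Definition large_digits N m : set R :=
  [set x | [/\ 0 <= x <= 1, infinite_expansion A x &
    forall k, (m < k)%N -> (N <= luroth_digit A x k)%N]].

Lemma luroth_digitS x k : luroth_digit A x k.+2 = luroth_digit A (luroth_map A x) k.+1.
Proof. by rewrite /luroth_digit /= -iterSr. Qed.

(** The first digit is peeled off. Two cases are joined: [m = 0], applied with [n0 = N], where
    [m.-1] is again 0 and the set reproduces itself; and [m > 0], where the first digit is free and
    [n0 = 1]. *)
Lemma large_digits_branch N m n0 : (0 < n0)%N -> (m = 0 -> n0 <= N)%N ->
  (0 < m -> n0 = 1)%N ->
  large_digits N m `<=` \bigcup_i luroth_branch (n0 + i) @` large_digits N m.-1.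
Proof.
move=> n00 mN m1 x [/andP[x0 x1] xinf dx].
have x01 : 0 < x <= 1.
  by rewrite x1 andbT lt_neqAle x0 andbT; apply/eqP => x0'; apply: (xinf 0%N).
have [xL Lx] := luroth_map_branch x01.
have [i0 _] := cell_indexP hA x01.
have ni : (n0 <= cell_index A x)%N.
  by case: m mN m1 dx => [mN _|m _ ->//] dx; rewrite (leq_trans (mN _))//; exact: (dx 1%N).
exists (cell_index A x - n0)%N => //; exists (luroth_map A x); last by rewrite subnKC.
split => // [k|]; first by rewrite -iterSr; exact: xinf.
by case=> // k mk; rewrite -luroth_digitS; apply: dx; move: mk; case: (m).
Qed.

Lemma premeasure_branch s n E : 0 <= s -> (0 < n)%N ->
  (hausdorff_premeasure s 1 (luroth_branch n @` E) <=
   (a n `^ s)%:E * hausdorff_premeasure s 1 E)%E.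
Proof.
move=> s0 n0; apply: premeasure_lipschitz => //.
  by rewrite cell_length_gt0//= cell_length_le1.
move=> x y; rewrite /luroth_branch.
have -> : t n - a n * x - (t n - a n * y) = - (a n * (x - y)) by ring.
by rewrite normrN normrM gtr0_norm// cell_length_gt0.
Qed.

(** At scale 1 the unit interval is itself an admissible cover. Finiteness is what lets [P <= P / 2]
    imply [P = 0] below. *)
Lemma premeasure_unit_lty (s : R) (E : set R) : E `<=` [set x | 0 <= x <= 1] ->
  (hausdorff_premeasure s 1 E < +oo)%E.
Proof.
set I : set R := [set x | 0 <= x <= 1].
move=> EI; pose U i : set R := if i == 0%N then I else set0.
have dI : (diam I <= 1%:E)%E.
  apply: diam_le => x y /andP[? ?] /andP[? ?].
  by rewrite lee_fin ler_norml; apply/andP; split; lra.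
have I0 : I !=set0 by exists 0; rewrite /I/= lexx ler01.
apply: (@le_lt_trans _ _ (\sum_(0 <= i <oo) diam_pow s (U i))%E).
  apply: premeasure_le_cover => [x Ex|[|i]]; first by exists 0%N => //; exact: EI.
    exact: dI.
  by rewrite /U/= /diam; apply: ge_ereal_sup => ? [? []].
rewrite (@nneseriesD1 R _ 0%N)//; last by move=> *; exact: diam_pow_ge0.
rewrite eseries0 ?adde0; last by move=> [|i]//= _ _; rewrite /U/= diam_pow_set0.
rewrite /U/= diam_pow_neq0//; apply: poweR_lty.
by apply: le_lt_trans dI _; rewrite ltry.
Qed.

Lemma premeasure_large_digits0 s N : 0 <= s -> (0 < N)%N ->
  (forall M, \sum_(N <= n < M) a n `^ s <= 2^-1) ->
  hausdorff_premeasure s 1 (large_digits N 0) = 0%E.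
Proof.
move=> s0 N0 hN; set P := hausdorff_premeasure _ _ _.
have P0 : (0 <= P)%E by exact: premeasure_ge0.
have Poo : (P < +oo)%E.
  by apply: premeasure_unit_lty => x [].
have [p Pp] : exists p, P = p%:E.
  by exists (fine P); rewrite fineK// ge0_fin_numE.
have p0 : 0 <= p by rewrite -lee_fin -Pp.
suff : (P <= (p / 2)%:E)%E by rewrite Pp lee_fin => pp; congr (_%:E); lra.
have sub := @large_digits_branch N 0 N N0 (fun=> leqnn N) (fun h => False_ind _ (notF h)).
apply: (le_trans (le_premeasure s 1 sub)).
apply: (le_trans (premeasure_bigcup _ _ _)).
apply: (@le_trans _ _ (\sum_(0 <= i <oo) (a (N + i) `^ s * p)%:E)%E).
  apply: lee_nneseries => [*|i _]; first exact: premeasure_ge0.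
  by rewrite EFinM -Pp; apply: premeasure_branch; rewrite // addn_gt0 N0.
have term0 i : 0 <= a (N + i) `^ s * p by rewrite mulr_ge0// powR_ge0.
apply: lime_le; first by apply: is_cvg_nneseries => *; rewrite lee_fin.
apply: nearW => M; rewrite sumEFin lee_fin -mulr_suml mulrC ler_wpM2l//.
suff -> : \sum_(0 <= i < M) a (N + i) `^ s = \sum_(0 + N <= i < M + N) a i `^ s.
  exact: hN.
by rewrite big_addn addnK; apply: eq_bigr => i _; rewrite addnC.
Qed.

(** Peeling off a free digit leaves countably many Lipschitz images of a null set. *)
Lemma premeasure_large_digits s N m : 0 <= s -> (0 < N)%N ->
  (forall M, \sum_(N <= n < M) a n `^ s <= 2^-1) ->
  hausdorff_premeasure s 1 (large_digits N m) = 0%E.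
Proof.
move=> s0 N0 hN; elim: m => [|m IH]; first exact: premeasure_large_digits0.
apply/eqP; rewrite eq_le premeasure_ge0 andbT.
have sub := @large_digits_branch N m.+1 1 isT.
apply: (le_trans (le_premeasure s 1 (sub _ _))) => //.
rewrite premeasure_bigcup_eq0// => i; apply/eqP; rewrite eq_le premeasure_ge0 andbT.
by apply: (le_trans (premeasure_branch _ s0 _)) => //=; rewrite IH mule0.
Qed.

Lemma hausdorff_dim_G_le (theta : R) : 0 <= theta ->
  expansive A theta -> eventually_decreasing A ->
  (hausdorff_dim (G_infty A) <= ((1 + theta)^-1)%:E)%E.
Proof.
move=> th0 hexp hdec; apply/lee_addgt0Pr => e e0.
have th1 : 0 < (1 + theta)^-1 by rewrite invr_gt0 ltr_wpDr.
apply: ereal_inf_lbound; exists ((1 + theta)^-1 + e) => //.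
have s0 : 0 < (1 + theta)^-1 + e by rewrite addr_gt0.
split; first exact: ltW.
have [|N N0 hN] := sum_cell_length_powR hA hexp hdec th0 (s := (1 + theta)^-1 + e).
  by rewrite ltrDl.
apply: (premeasure_eq0_hausdorff (d := 1)) => //.
apply/eqP; rewrite eq_le premeasure_ge0 andbT.
rewrite -(@premeasure_bigcup_eq0 _ ((1 + theta)^-1 + e) 1 (large_digits N)); last first.
  by move=> m; apply: premeasure_large_digits => //; exact: ltW.
apply: le_premeasure => x [x01 xinf dx].
have [m _ hm] := dx _ (nbhs_infty_ge N).
by exists m => //; split => // k mk; apply: hm => /=; exact: ltnW.
Qed.

End UpperBound.

(** * Coding of ]0,1] by points of [F_infty], and its Hoelder inverse *)

Section Coding.
Context {R : realType}.
Variable A : nat -> set R.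
Hypothesis hA : luroth_partition A.

Let t := cell_tail A.
Let a := cell_length A.

(* A point [y] uniform in ]0,1] is turned into a random sequence of strictly
   increasing digits: given the last digit [j], the next one is [k > j] with
   probability [a k / t j.+1]. *)
Definition next_digit j (y : R) : nat := cell_index A (t j.+1 * y).

(* The affine map from the cell onto ]0,1] is taken increasing, unlike
   [luroth_map], so that the parameter never hits 0. *)
Definition next_param j (y : R) : R :=
  (t j.+1 * y - t (next_digit j y).+1) / a (next_digit j y).

(** The branches of the first [n] digits, composed and applied to 0. *)
Fixpoint code_approx n j (y : R) : R :=
  if n is n'.+1 then
    luroth_branch A (next_digit j y)
      (code_approx n' (next_digit j y) (next_param j y))
  else 0.

Definition code j (y : R) : R := limn (fun n => code_approx n j y).

(** The scaled point [t j.+1 * y] is at most [t j.+1], hence left of the cell [j], which forces a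
    larger digit. The last equation recovers [y] from digit and new parameter. *)
Lemma next_digitP j y : (0 < j)%N -> 0 < y <= 1 -> let k := next_digit j y in
  [/\ (j < k)%N, t k.+1 < t j.+1 * y <= t k, 0 < next_param j y <= 1 &
     t j.+1 * y = t k.+1 + a k * next_param j y].
Proof.
move=> j0 /andP[y0 y1] k.
have tj0 : 0 < t j.+1 by exact: cell_tail_gt0.
have tj1 : t j.+1 <= 1 by exact: cell_tail_le1.
have z01 : 0 < t j.+1 * y <= 1 by rewrite mulr_gt0// mulr_ile1// ltW.
have [k0 zk] := cell_indexP hA z01.
have ak : 0 < a k by exact: cell_length_gt0.
have akE : a k = t k - t k.+1 by exact: cell_lengthE.
rewrite -/t -/(next_digit j y) -/k in zk.
split => //.
- rewrite ltnNge; apply/negP => kj.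
  have := @cell_tail_le _ _ hA k.+1 j.+1 isT kj; rewrite -/t.
  have : t j.+1 * y <= t j.+1 by rewrite ger_pMr.
  by case/andP: zk; lra.
- rewrite /next_param -/k; case/andP: zk => zl zr.
  by rewrite divr_gt0 ?subr_gt0//= ler_pdivrMr// mul1r akE lerD2r.
- by rewrite /next_param -/k [a k * _]mulrC divfK ?gt_eqF//; ring.
Qed.

(** Conditions on a threshold [N]: [a_powR_le] drives the Hoelder estimate, [a_decr] compares two
    different first digits, and [t_small] keeps codes in the right halves of their cells and makes
    the branches contract. *)
Variables (s : R) (N : nat).
Hypothesis s01 : 0 <= s <= 1.
Hypothesis N0 : (0 < N)%N.
Hypothesis a_powR_le : forall n, (N <= n)%N -> a n `^ (1 - s) <= t n.+1.
Hypothesis a_decr : forall m n, (N <= m)%N -> (m <= n)%N -> a n <= a m.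
Hypothesis t_small : forall n, (N <= n)%N -> t n.+1 <= 2^-1.

Lemma cell_length_le_tail k : (N <= k)%N -> a k <= t k.+1.
Proof.
move=> Nk; have k0 : (0 < k)%N by exact: leq_trans Nk.
apply: le_trans (a_powR_le Nk); apply: ger1_powR.
  by rewrite cell_length_gt0//= cell_length_le1.
by case/andP: s01; rewrite lerBlDr lerDl.
Qed.

Lemma code_approx_bound n j y : (N <= j)%N -> 0 < y <= 1 ->
  0 <= code_approx n j y <= t j.+1.
Proof.
elim: n j y => [|n IH] j y Nj y01 /=.
  by rewrite lexx ltW//; exact: cell_tail_gt0.
have [jk _ r01 _] := next_digitP (leq_trans N0 Nj) y01.
set k := next_digit j y in jk *.
have Nk : (N <= k)%N by exact: leq_trans Nj (ltnW jk).
have k0 : (0 < k)%N by exact: leq_ltn_trans jk.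
have /andP[x0 xt] := IH _ _ Nk r01.
have tk1 : t k.+1 <= 1 by exact: cell_tail_le1.
have tk0 : 0 < t k.+1 by exact: cell_tail_gt0.
have tkj : t k <= t j.+1 by exact: cell_tail_le.
have ak : 0 < a k by exact: cell_length_gt0.
have akE : a k = t k - t k.+1 by exact: cell_lengthE.
rewrite /luroth_branch -/t -/a.
set x := code_approx _ _ _ in x0 xt *.
have ax0 : 0 <= a k * x by rewrite mulr_ge0// ltW.
have ax1 : a k * x <= a k by rewrite ger_pMr//; lra.
by apply/andP; split; lra.
Qed.

(** Every branch in use contracts by [a k <= t k.+1 <= 1 / 2]. *)
Lemma code_approx_cauchy n j y : (N <= j)%N -> 0 < y <= 1 ->
  `|code_approx n.+1 j y - code_approx n j y| <= 2^-1 ^+ n.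
Proof.
elim: n j y => [|n IH] j y Nj y01.
  rewrite subr0 expr0.
  have /andP[x0 xt] := code_approx_bound 1 Nj y01.
  by rewrite ger0_norm// (le_trans xt)// /t cell_tail_le1.
have [jk _ r01 _] := next_digitP (leq_trans N0 Nj) y01.
rewrite [code_approx n.+2 j y]/= [code_approx n.+1 j y in X in _ - X]/=.
set k := next_digit j y in jk *.
have Nk : (N <= k)%N by exact: leq_trans Nj (ltnW jk).
have ak : 0 < a k by apply: cell_length_gt0 => //; lia.
have ak2 : a k <= 2^-1 by apply: le_trans (cell_length_le_tail Nk) (t_small Nk).
have := IH _ _ Nk r01.
rewrite /luroth_branch -/t -/a -/(code_approx n.+1 k (next_param j y)).
set x := code_approx n.+1 _ _; set x' := code_approx n _ _ => h.
have -> : t k - a k * x - (t k - a k * x') = - (a k * (x - x')) by ring.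
by rewrite normrN normrM gtr0_norm// exprS ler_pM// ltW.
Qed.

Lemma is_cvg_code_approx j y : (N <= j)%N -> 0 < y <= 1 ->
  cvgn (fun n => code_approx n j y).
Proof.
(* The added term drops by exactly [2^-1 ^+ n] at step [n], which offsets any increase of the
   approximations and makes [w] nonincreasing. *)
move=> Nj y01; pose w n : R := code_approx n j y + 2 * 2^-1 ^+ n.
have cw : cvgn w.
  apply: nonincreasing_is_cvgn.
    apply: homo_leq => [//|x z v xz zv|n]; first exact: le_trans zv xz.
    have := code_approx_cauchy n Nj y01; rewrite /w exprS ler_norml => /andP[_].
    by lra.
  exists 0 => _ [n _ <-]; rewrite /w.
  have /andP[x0 _] := code_approx_bound n Nj y01.
  by rewrite addr_ge0// mulr_ge0// exprn_ge0// invr_ge0.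
have cg : (fun n => 2 * 2^-1 ^+ n : R) @ \oo --> 0.
  by apply: cvg_geometric; rewrite ger0_norm ?invr_ge0//; lra.
rewrite (_ : (fun n => _) = w \- (fun n => 2 * 2^-1 ^+ n)); last first.
  by apply/funext => n; rewrite /w /= addrK.
by apply: is_cvgB => //; apply/cvg_ex; exists 0.
Qed.

Lemma code_bound j y : (N <= j)%N -> 0 < y <= 1 -> 0 <= code j y <= t j.+1.
Proof.
move=> Nj y01; have cv := is_cvg_code_approx Nj y01.
apply/andP; split.
  by apply: limr_ge => //; apply: nearW => n; have /andP[] := code_approx_bound n Nj y01.
by apply: limr_le => //; apply: nearW => n; have /andP[] := code_approx_bound n Nj y01.
Qed.

Lemma codeE j y : (N <= j)%N -> 0 < y <= 1 ->
  code j y = luroth_branch A (next_digit j y) (code (next_digit j y) (next_param j y)).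
Proof.
move=> Nj y01.
have [jk _ r01 _] := next_digitP (leq_trans N0 Nj) y01.
have Nk : (N <= next_digit j y)%N by lia.
apply/cvg_lim => //; rewrite -(cvg_shiftS (fun n => code_approx n j y)) /=.
apply: cvgB; first exact: cvg_cst.
by apply: cvgM; [exact: cvg_cst | exact: is_cvg_code_approx].
Qed.

(** The code of the remaining digits is at most [t k.+1 <= 1 / 2], so the point stays in the right
    half of its cell: off the excluded left end, and at a distance from all later cells. *)
Lemma code_cell j y : (N <= j)%N -> 0 < y <= 1 ->
  t (next_digit j y) - a (next_digit j y) / 2 <= code j y <= t (next_digit j y).
Proof.
move=> Nj y01; rewrite codeE//.
have [jk _ r01 _] := next_digitP (leq_trans N0 Nj) y01.
set k := next_digit j y in jk *.
have Nk : (N <= k)%N by exact: leq_trans Nj (ltnW jk).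
have ak : 0 < a k by apply: cell_length_gt0 => //; lia.
have /andP[x0 xt] := code_bound Nk r01.
have x2 := le_trans xt (t_small Nk).
rewrite /luroth_branch -/t -/a.
by rewrite lerD2l lerN2 ler_pM2l// x2 gerBl mulr_ge0// ltW.
Qed.

Lemma cell_index_code j y : (N <= j)%N -> 0 < y <= 1 ->
  cell_index A (code j y) = next_digit j y.
Proof.
move=> Nj y01; have /andP[xl xr] := code_cell Nj y01.
have [jk _ r01 _] := next_digitP (leq_trans N0 Nj) y01.
set k := next_digit j y in jk xl xr *.
have k0 : (0 < k)%N by exact: leq_ltn_trans jk.
have ak : 0 < a k by apply: cell_length_gt0 => //; lia.
have akE : a k = t k - t k.+1 by exact: cell_lengthE.
by apply: cell_indexE => //; rewrite -/t xr andbT; lra.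
Qed.

Lemma luroth_map_code j y : (N <= j)%N -> 0 < y <= 1 ->
  luroth_map A (code j y) = code (next_digit j y) (next_param j y).
Proof.
move=> Nj y01; rewrite /luroth_map cell_index_code// codeE// -/t -/a.
have [jk _ r01 _] := next_digitP (leq_trans N0 Nj) y01.
have k0 : (0 < next_digit j y)%N by lia.
have ak : a (next_digit j y) != 0 by rewrite gt_eqF// cell_length_gt0.
by rewrite gtn_eqF// /luroth_branch -/t -/a; field.
Qed.

(** Latest digit and current parameter; the initial [N] acts as a digit preceding the expansion. *)
Definition code_state (y : R) n : nat * R :=
  iter n (fun p => (next_digit p.1 p.2, next_param p.1 p.2)) (N, y).

Lemma code_stateP y n : 0 < y <= 1 ->
  (N + n <= (code_state y n).1)%N /\ 0 < (code_state y n).2 <= 1.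
Proof.
move=> y01; elim: n => [|n [IH1 IH2]]; first by rewrite addn0.
have Nj : (0 < (code_state y n).1)%N by lia.
have [jk _ r01 _] := next_digitP Nj IH2.
by split => //=; rewrite addnS; apply: leq_ltn_trans jk.
Qed.

Lemma iter_luroth_code y n : 0 < y <= 1 ->
  iter n (luroth_map A) (code N y) = code (code_state y n).1 (code_state y n).2.
Proof.
move=> y01; elim: n => //= n ->.
have [Nn r01] := code_stateP n y01.
by rewrite luroth_map_code//; lia.
Qed.

Lemma luroth_digit_code y n : 0 < y <= 1 ->
  luroth_digit A (code N y) n.+1 = (code_state y n.+1).1.
Proof.
move=> y01; rewrite /luroth_digit /= iter_luroth_code//.
have [Nn r01] := code_stateP n y01.
by rewrite cell_index_code//; lia.
Qed.

Lemma code_F y : 0 < y <= 1 -> F_infty A (code N y).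
Proof.
move=> y01; split.
- have /andP[-> h] := code_bound (leqnn N) y01.
  by rewrite (le_trans h)// /t cell_tail_le1.
- move=> n; rewrite iter_luroth_code//.
  have [Nn r01] := code_stateP n y01.
  have Nj : (N <= (code_state y n).1)%N by lia.
  have /andP[xl _] := code_cell Nj r01.
  have [jk _ _ _] := next_digitP (leq_trans N0 Nj) r01.
  set k := next_digit _ _ in jk xl.
  have k0 : (0 < k)%N by exact: leq_ltn_trans jk.
  have ak : 0 < a k by apply: cell_length_gt0.
  have akE : a k = t k - t k.+1 by exact: cell_lengthE.
  have : 0 < t k.+1 by exact: cell_tail_gt0.
  by move=> tk; apply/eqP; rewrite gt_eqF//; lra.
- apply/cvgnyPge => M; exists M.+1 => // -[//|n] /= Mn.
  rewrite luroth_digit_code//; have [h _] := code_stateP n.+1 y01; lia.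
- case=> [//|[//|n]] _; rewrite /= !luroth_digit_code//.
  have [Nn r01] := code_stateP n.+1 y01.
  have Nj : (0 < (code_state y n.+1).1)%N by lia.
  by have [jk _ _ _] := next_digitP Nj r01; exact: ltnW.
Qed.

(* With [D := t k - t k'] the codes are at least [D - a k / 2 >= D / 2] apart,
   the parameters at most [(D + a k') / t j.+1 <= 2 * D / t j.+1]. *)
Lemma code_separated j y y' : (N <= j)%N -> 0 < y <= 1 -> 0 < y' <= 1 ->
  (next_digit j y < next_digit j y')%N ->
  `|y - y'| <= 4 * `|code j y - code j y'| `^ s / t j.+1.
Proof.
move=> Nj y01 y01'.
have j0 := leq_trans N0 Nj.
have [jk /andP[zl zr] _ _] := next_digitP j0 y01.
have [jk' /andP[zl' zr'] _ _] := next_digitP j0 y01'.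
have /andP[xl xr] := code_cell Nj y01.
have /andP[xl' xr'] := code_cell Nj y01'.
set k := next_digit j y in jk zl zr xl xr *.
set k' := next_digit j y' in jk' zl' zr' xl' xr' * => kk'.
set x := code j y in xl xr *; set x' := code j y' in xl' xr' *.
have Nk : (N <= k)%N by exact: leq_trans Nj (ltnW jk).
have k0 : (0 < k)%N by exact: leq_ltn_trans jk.
have k0' : (0 < k')%N by exact: leq_ltn_trans jk'.
have ak : 0 < a k by exact: cell_length_gt0.
have akE : a k = t k - t k.+1 by exact: cell_lengthE.
have akE' : a k' = t k' - t k'.+1 by exact: cell_lengthE.
have akk' : a k' <= a k by apply: a_decr => //; exact: ltnW.
have tkk' : t k' <= t k.+1 by exact: cell_tail_le.
have t1 : t k <= 1 by exact: cell_tail_le1.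
have tj : 0 < t j.+1 by exact: cell_tail_gt0.
have x0' : 0 <= x' by have /andP[] := code_bound Nj y01'.
have xx' : a k / 2 <= x - x' by lra.
have xx1 : x - x' <= 1 by lra.
have xx0 : 0 < x - x' by lra.
rewrite [`|x - x'|]gtr0_norm// ler_pdivlMr//.
(* As the distance is at most 1 and [s <= 1], a linear bound implies the Hoelder bound. *)
have xs : x - x' <= (x - x') `^ s.
  by apply: ger1_powR; [rewrite xx0 | case/andP: s01].
have yy : t j.+1 * y - t j.+1 * y' <= 4 * (x - x') by lra.
have yy' : y' <= y by rewrite -(ler_pM2l tj); lra.
rewrite ger0_norm ?subr_ge0// mulrC mulrBr; lra.
Qed.

(** Induction on the number of digits compared: different first digits are settled by separation, a
    common one rescales both sides, and the error term covers the case where no digits are left to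
    compare. *)
Lemma code_hoelder_approx n j y y' : (N <= j)%N -> 0 < y <= 1 -> 0 < y' <= 1 ->
  `|y - y'| <= 4 * `|code j y - code j y'| `^ s / t j.+1 + 2^-1 ^+ n.
Proof.
elim: n j y y' => [|n IH] j y y' Nj y01 y01'.
  have tj : 0 < t j.+1 by exact: cell_tail_gt0.
  have c0 : 0 <= 4 * `|code j y - code j y'| `^ s / t j.+1.
    by rewrite divr_ge0 ?mulr_ge0 ?powR_ge0// ltW.
  rewrite expr0 ler_norml; case/andP: y01 => ? ?; case/andP: y01' => ? ?.
  by apply/andP; split; lra.
have e0 : 0 <= 2^-1 ^+ n.+1 :> R by rewrite exprn_ge0// invr_ge0.
case: (ltngtP (next_digit j y) (next_digit j y')) => kk'.
- by apply: (le_trans (code_separated Nj y01 y01' kk')); rewrite lerDl.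
- rewrite distrC [X in X `^ s]distrC.
  by apply: (le_trans (code_separated Nj y01' y01 kk')); rewrite lerDl.
have j0 := leq_trans N0 Nj.
have [jk _ r01 zE] := next_digitP j0 y01.
have [_ _ r01' zE'] := next_digitP j0 y01'.
rewrite (codeE Nj y01) (codeE Nj y01') -kk'; rewrite -kk' in r01' zE'.
set k := next_digit j y in jk r01 zE r01' zE' *.
set r := next_param j y in r01 zE *; set r' := next_param j y' in r01' zE' *.
have Nk : (N <= k)%N by exact: leq_trans Nj (ltnW jk).
have k0 : (0 < k)%N by exact: leq_ltn_trans jk.
have ak : 0 < a k by exact: cell_length_gt0.
have akE : a k = t k - t k.+1 by exact: cell_lengthE.
have tj : 0 < t j.+1 by exact: cell_tail_gt0.
have tk : 0 < t k.+1 by exact: cell_tail_gt0.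
have tkj : t k <= t j.+1 by exact: cell_tail_le.
have akt := cell_length_le_tail Nk.
have := IH k r r' Nk r01 r01'.
set x := code k r; set x' := code k r'; rewrite /luroth_branch -/t -/a.
have -> : t k - a k * x - (t k - a k * x') = - (a k * (x - x')) by ring.
rewrite normrN normrM (gtr0_norm ak) powRM ?(ltW ak)//.
set D := `|x - x'| `^ s => h.
have D0 : 0 <= D by exact: powR_ge0.
have as0 : 0 < a k `^ s by exact: powR_gt0.
(* A common digit [k] scales codes by [a k] and parameters by [a k / t j.+1]; this inequality
   absorbs the change of denominator from [t k.+1] to [t j.+1]. *)
have aps : a k <= a k `^ s * t k.+1.
  rewrite -[leLHS]powRr1 ?(ltW ak)// -{1}(subrK s 1) addrC powRD; last first.
    by apply/implyP => _; rewrite gt_eqF.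
  by rewrite ler_pM2l// a_powR_le.
have -> : y - y' = a k * (r - r') / t j.+1.
  apply: (@mulfI _ (t j.+1)); first by rewrite gt_eqF.
  by rewrite mulrBr zE zE'; field; rewrite gt_eqF.
rewrite !normrM (gtr0_norm ak) normfV (gtr0_norm tj).
have aptk : a k / t k.+1 <= a k `^ s by rewrite ler_pdivrMr.
(* From [a k <= t k.+1 = t k - a k] and [t k <= t j.+1]; it halves the error term. *)
have ajk : a k <= t j.+1 / 2 by lra.
have e1 : 0 <= 2^-1 ^+ n :> R by rewrite exprn_ge0// invr_ge0.
rewrite ler_pdivrMr// mulrDl divfK ?gt_eqF// exprS.
apply: (le_trans (ler_wpM2l (ltW ak) h)); rewrite mulrDr; apply: lerD.
  have -> : a k * (4 * D / t k.+1) = 4 * (a k / t k.+1 * D) by ring.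
  by rewrite ler_pM2l// ler_wpM2r.
have -> : 2^-1 * 2^-1 ^+ n * t j.+1 = t j.+1 / 2 * 2^-1 ^+ n by ring.
by rewrite ler_wpM2r.
Qed.

Lemma code_hoelder j y y' : (N <= j)%N -> 0 < y <= 1 -> 0 < y' <= 1 ->
  `|y - y'| <= 4 * `|code j y - code j y'| `^ s / t j.+1.
Proof.
move=> Nj y01 y01'.
set b := 4 * _ / _.
have cg : (fun n => 1 * 2^-1 ^+ n : R) @ \oo --> 0.
  by apply: cvg_geometric; rewrite ger0_norm ?invr_ge0//; lra.
have cb : (fun n => b + 1 * 2^-1 ^+ n) @ \oo --> b.
  by rewrite -[X in _ --> X]addr0; apply: cvgD => //; exact: cvg_cst.
rewrite -(cvg_lim _ cb)//; apply: limr_ge; first by apply/cvg_ex; exists b.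
by apply: nearW => n; rewrite mul1r; exact: code_hoelder_approx.
Qed.

End Coding.

(** * Lower bound for the dimension of [F_infty] *)

Section LowerBound.
Context {R : realType}.
Variable A : nat -> set R.
Hypothesis hA : luroth_partition A.

(** Mass distribution: a cover of [F_infty] pulls back through [code] to a cover of ]0,1], and each
    piece has length at most a constant times the weight of its set. *)
Lemma hausdorff_measure_F_neq0 (theta s : R) : 0 <= theta ->
  expansive A theta -> eventually_decreasing A ->
  0 <= s -> s < (1 + theta)^-1 -> hausdorff_measure s (F_infty A) != 0%E.
Proof.
move=> th0 hexp hdec s0 hs.
have s1 : s <= 1.
  by rewrite (le_trans (ltW hs))// invf_le1 ?ltr_wpDr// lerDl.
have s01 : 0 <= s <= 1 by rewrite s0.
have [N1 _ hN1] := near_cell_length_tail hA hexp hdec th0 s0 hs.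
have [N2 hN2] := near_cell_length_decreasing hdec.
have [N3 _ hN3] : \forall n \near \oo, cell_tail A n <= 2^-1.
  by apply: (cvgr_le _ (cvg_cell_tail hA)); rewrite invr_gt0.
pose N := (N1 + N2 + N3).+1.
have N0 : (0 < N)%N by [].
have h1 n : (N <= n)%N -> cell_length A n `^ (1 - s) <= cell_tail A n.+1.
  by rewrite /N => Nn; apply: hN1 => /=; lia.
have h2 m n : (N <= m)%N -> (m <= n)%N -> cell_length A n <= cell_length A m.
  by rewrite /N => Nm mn; apply: hN2 => //; lia.
have h3 n : (N <= n)%N -> cell_tail A n.+1 <= 2^-1.
  by rewrite /N => Nn; apply: hN3 => /=; lia.
pose f := code A N.
have fF y : 0 < y <= 1 -> F_infty A (f y) by exact: (code_F hA s01 N0 h1 h3).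
pose t := cell_tail A N.+1.
have t0 : 0 < t by exact: cell_tail_gt0.
have fH y y' : 0 < y <= 1 -> 0 < y' <= 1 -> `|y - y'| <= 4 * `|f y - f y'| `^ s / t.
  exact: (code_hoelder hA s01 N0 h1 h2 h3 (leqnn N)).
suff : ((t / 8)%:E <= hausdorff_premeasure s 1 (F_infty A))%E.
  move=> h; rewrite gt_eqF//; apply: (@lt_le_trans _ _ (t / 8)%:E).
    by rewrite lte_fin divr_gt0.
  by apply: (le_trans h); apply: ereal_sup_ubound; exists 1 => //=.
apply: le_ereal_inf_tmp => _ [U [FU U1] <-].
pose V i := [set y | 0 < y <= 1 /\ U i (f y)].
(* [V i] need not be measurable, so it is enclosed in an interval around one of its points, with the
   Hoelder bound as radius; 8 is twice the constant 4 there. *)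
have hW i : exists W : set R, [/\ measurable W, V i `<=` W &
    (lebesgue_measure W <= (8 / t)%:E * diam_pow s (U i))%E].
  have [V0|/set0P[y0 [y001 Uy0]]] := eqVneq (V i) set0.
    exists set0; split => //; first by rewrite V0.
    by rewrite measure0 mule_ge0 ?diam_pow_ge0// lee_fin divr_ge0// ltW.
  have Ui0 : U i !=set0 by exists (f y0).
  have [d dE] : exists d, diam (U i) = d%:E.
    exists (fine (diam (U i))); rewrite fineK// ge0_fin_numE ?diam_ge0//.
    by apply: le_lt_trans (U1 i) _; rewrite ltry.
  have d0 : 0 <= d by rewrite -lee_fin -dE diam_ge0.
  pose r := 4 * d `^ s / t.
  have r0 : 0 <= r by rewrite divr_ge0 ?mulr_ge0 ?powR_ge0// ltW.
  exists `[y0 - r, y0 + r]%classic; split => //.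
    move=> y [y01 Uy]; rewrite /= in_itv/= -ler_distl.
    apply: (le_trans (fH _ _ y01 y001)).
    rewrite ler_pM2r ?invr_gt0// ler_pM2l//.
    apply: ge0_ler_powR => //; rewrite ?nnegrE//.
    by rewrite -lee_fin -dE; exact: le_diam.
  rewrite diam_pow_neq0// dE poweR_EFin -EFinM lebesgue_measure_itv/= lte_fin.
  (* The second case is [r = 0], where the interval is a single point. *)
  case: ifP => _; rewrite ?lee_fin ?EFinN -?EFinD ?lee_fin.
    by rewrite /r le_eqVlt; apply/orP; left; apply/eqP; field; rewrite gt_eqF.
  by rewrite mulr_ge0 ?powR_ge0// divr_ge0// ltW.
have [W hW'] := choice hW.
have : (lebesgue_measure (`]0%R, 1%R]%classic : set R) <=
    \sum_(0 <= i <oo) lebesgue_measure (W i))%E.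
  apply: measure_sigma_subadditive => //.
    by move=> i; case: (hW' i).
  move=> y; rewrite /= in_itv/= => y01.
  have [i _ Ui] := FU _ (fF _ y01).
  by exists i => //; case: (hW' i) => _ + _; apply.
rewrite lebesgue_measure_itv/= lte_fin ltr01 oppr0 adde0 => h.
rewrite -(@lee_pmul2l _ (8 / t)%:E)// ?lte_fin ?divr_gt0//.
rewrite -EFinM (_ : 8 / t * (t / 8) = 1); last by field; rewrite gt_eqF.
apply: (le_trans h); rewrite -nneseriesZl; last by move=> i _; exact: diam_pow_ge0.
by apply: lee_nneseries => // i _; case: (hW' i).
Qed.

End LowerBound.

Theorem theorem2 (R : realType) (A : nat -> set R) (theta : R)
    (hA : luroth_partition A) (htheta : 0 <= theta)
    (hexp : expansive A theta) (hdec : eventually_decreasing A) :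
  hausdorff_dim (F_infty A) = hausdorff_dim (G_infty A) /\
  hausdorff_dim (G_infty A) = (1 / (1 + theta))%:E.
Proof.
rewrite div1r.
have FG : (hausdorff_dim (F_infty A) <= hausdorff_dim (G_infty A))%E.
  by apply: le_hausdorff_dim => x [].
have G := hausdorff_dim_G_le hA htheta hexp hdec.
have F : (((1 + theta)^-1)%:E <= hausdorff_dim (F_infty A))%E.
  apply: le_ereal_inf_tmp => _ [s [s0 sF] <-]; rewrite lee_fin leNgt.
  apply/negP => hs.
  by have := hausdorff_measure_F_neq0 hA htheta hexp hdec s0 hs; rewrite sF eqxx.
by split; apply/eqP; rewrite eq_le; apply/andP; split=> //;
  [exact: le_trans F | exact: le_trans FG].
Qed.
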